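(* For all integers $n \ge 5$ and $r \ge 4$, the Hadamard critical exponent of the class of $n \times n$ symmetric TN$_r$ matrices is $\infty$, and the Hadamard critical exponent of the class of $n \times n$ symmetric TP$_r$ matrices is $\infty$.
   Context: All matrices have real entries. A matrix is TN$_r$ (totally nonnegative of order $r$) if every minor (determinant of a square submatrix) of size $\le r$ is nonnegative, and TP$_r$ (totally positive of order $r$) if every minor of size $\le r$ is positive. For a matrix $A=(a_{ij})$ with nonnegative real entries and real $t>0$, the Hadamard (entrywise) power is $A^{\circ t}=(a_{ij}^t)$ (with $0^t=0$). The Hadamard critical exponent of a class $\mathcal{C}$ of matrices with nonnegative entries is the infimum of the real numbers $T>0$ such that $A^{\circ t}\in\mathcal{C}$ for all $A\in\mathcal{C}$ and all real $t \ge T$; it is $\infty$ if no such $T$ exists. *)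

(* Defs.v *)
From HB Require Import structures.
From mathcomp Require Import all_boot all_order all_algebra.
From mathcomp Require Import all_classical all_reals all_analysis.

Set Implicit Arguments.
Unset Strict Implicit.
Unset Printing Implicit Defensive.

Import Order.TTheory GRing.Theory Num.Theory.

Local Open Scope classical_set_scope.
Local Open Scope ring_scope.

(* Strictly increasing index maps 'I_k -> 'I_n are the k-element subsets of
   'I_n listed in order; none exist for k > n, and k = 0 gives the empty
   minor, equal to 1. *)
Definition increasing_index (k n : nat) (f : 'I_k -> 'I_n) : Prop :=
  forall i j : 'I_k, (i < j)%N -> (f i < f j)%N.

Definition TN (R : realType) (r m n : nat) (A : 'M[R]_(m, n)) : Prop :=
  forall (k : nat) (f : 'I_k -> 'I_m) (g : 'I_k -> 'I_n), (k <= r)%N ->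
    increasing_index f -> increasing_index g -> 0 <= \det (mxsub f g A).

Definition TP (R : realType) (r m n : nat) (A : 'M[R]_(m, n)) : Prop :=
  forall (k : nat) (f : 'I_k -> 'I_m) (g : 'I_k -> 'I_n), (k <= r)%N ->
    increasing_index f -> increasing_index g -> 0 < \det (mxsub f g A).

Definition symTN (R : realType) (r n : nat) : set 'M[R]_n :=
  [set A | A^T = A /\ TN r A].

Definition symTP (R : realType) (r n : nat) : set 'M[R]_n :=
  [set A | A^T = A /\ TP r A].

Arguments symTN R r n : clear implicits.
Arguments symTP R r n : clear implicits.

(* Meant for entrywise nonnegative A and t > 0, where powR 0 t = 0. *)
Definition hadamard_power (R : realType) (m n : nat) (A : 'M[R]_(m, n))
  (t : R) : 'M[R]_(m, n) := map_mx (fun x => x `^ t) A.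

(* Meant for classes C of entrywise nonnegative matrices.  The infimum is taken
   in \bar R, where the infimum of the empty set is +oo. *)
Definition hadamard_critical_exponent (R : realType) (m n : nat)
  (C : set 'M[R]_(m, n)) : \bar R :=
  ereal_inf [set T%:E | T in [set T : R | 0 < T /\
    forall A, C A -> forall t : R, T <= t -> C (hadamard_power A t)]].

(* Main.v *)
(** The powers already fail near the matrix with entries
    (i+1)(j+1) + e (i j + (i-2)_+ (j-2)_+), which is S^2 D (S^2)^T for S the
    lower triangular matrix of ones and D = diag(1, e, 0, e, 0, ..., 0).  Up to
    row and column scaling it is 1 + e (w_i w_j + z_i z_j) with w_i = i/(i+1)
    and z_i = (i-2)_+/(i+1), and the curve z/w against w is convex through the
    points i = 1, 2, 3 but concave through i = 2, 3, 4.  Since w and z span a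
    space of dimension 2, the minor on rows 0, 1, 2, 3 and columns 0, 2, 3, 4
    of the m-th power has order e^4, and the change of convexity makes its
    leading coefficient negative for every m > 1.

    To reach totally positive matrices, S is replaced by the Cauchy matrix
    x_i / (x_i + y_j), with x_i = h^-(2i+1) and y_j = h^-2j, which tends to S
    as h -> 0, and the zero weights in D by h.  All minors of Cauchy matrices
    with increasing nodes are positive, and the Cauchy-Binet formula passes
    this to products.  The minor above stays negative for small h, so for
    every integer m > 1 some symmetric totally positive matrix has an m-th
    power which is not even TN_4. *)

Require Import Defs.
From mathcomp Require Import all_boot all_order all_fingroup all_algebra.
From mathcomp Require Import all_classical all_reals all_analysis.
From mathcomp Require Import ring lra zify.

Set Implicit Arguments.
Unset Strict Implicit.
Unset Printing Implicit Defensive.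

Import Order.TTheory GRing.Theory Num.Theory.

Import numFieldNormedType.Exports.

Local Open Scope classical_set_scope.
Local Open Scope ring_scope.

(** * Schur complements, Cauchy determinants and the Cauchy-Binet formula *)

Lemma det_scale (R : comNzRingType) (n : nat) (a b : 'I_n -> R)
    (M : 'M[R]_n) :
  \det (\matrix_(i, j) (a i * M i j * b j)) =
  (\prod_i a i) * \det M * \prod_i b i.
Proof.
have -> : \matrix_(i, j) (a i * M i j * b j) =
    diag_mx (\row_i a i) *m M *m diag_mx (\row_i b i).
  by apply/matrixP=> i j; rewrite mul_mx_diag mul_diag_mx !mxE.
by rewrite !det_mulmx !det_diag; congr (_ * _ * _);
  apply: eq_bigr => i _; rewrite mxE.
Qed.

Lemma det_schur (F : fieldType) (n : nat) (M : 'M[F]_n.+1) : M 0 0 != 0 ->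
  \det M = M 0 0 * \det (\matrix_(i, j)
    (M (lift 0 i) (lift 0 j) - M (lift 0 i) 0 * M 0 (lift 0 j) / M 0 0)).
Proof.
move=> M00; rewrite -[n.+1]/(1 + n)%N in M M00 *.
pose L : 'M[F]_(1 + n) :=
  block_mx 1%:M 0 (- (M 0 0)^-1 *: dlsubmx M) 1%:M.
have dL : \det L = 1 by rewrite det_lblock !det1 mulr1.
rewrite -[LHS]mul1r -dL -det_mulmx -{1}(submxK M) mulmx_block.
rewrite !mul0mx !mul1mx !addr0.
have -> : - (M 0 0)^-1 *: dlsubmx M *m ulsubmx M + dlsubmx M = 0.
  apply/matrixP=> i j; rewrite !mxE big_ord1 !mxE !ord1 !lshift0.
  by rewrite mulrAC mulNr mulVf // mulN1r addNr.
rewrite det_ublock det_mx11 !mxE !lshift0; congr (_ * \det _).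
apply/matrixP=> i j; rewrite !mxE big_ord1 !mxE !lshift0 !rshift1 addrC.
by rewrite !mulNr; congr (_ - _); rewrite [RHS]mulrC mulrA.
Qed.

(* The Schur complement of a Cauchy matrix is a rescaled Cauchy matrix. *)
Lemma det_cauchy_gt0 (F : realFieldType) (k : nat) (x y : 'I_k -> F) :
  (forall i, 0 < x i) -> (forall i, 0 < y i) ->
  (forall i j : 'I_k, (i < j)%N -> x i < x j) ->
  (forall i j : 'I_k, (i < j)%N -> y i < y j) ->
  0 < \det (\matrix_(i, j) (x i + y j)^-1).
Proof.
elim: k x y => [|k IHk] x y x0 y0 xlt ylt; first by rewrite det_mx00.
have xy i j : 0 < x i + y j by rewrite addr_gt0.
rewrite det_schur ?mxE ?gt_eqF ?invr_gt0 //.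
rewrite mulr_gt0 ?invr_gt0 //.
pose a (i : 'I_k) := (x (lift 0 i) - x 0) / (x (lift 0 i) + y 0).
pose b (j : 'I_k) := (y (lift 0 j) - y 0) / (x 0 + y (lift 0 j)).
pose C := \matrix_(i < k, j < k) (x (lift 0 i) + y (lift 0 j))^-1.
rewrite [X in \det X](_ : _ = \matrix_(i, j) (a i * C i j * b j)); last first.
  apply/matrixP=> i j; rewrite !mxE /a /b.
  by field; rewrite !gt_eqF.
rewrite det_scale !mulr_gt0 ?prodr_gt0 // => [i _||i _].
- by rewrite /a divr_gt0 // subr_gt0 xlt.
- by apply: IHk => // i j ij; [apply: xlt | apply: ylt]; rewrite !lift0.
- by rewrite /b divr_gt0 // subr_gt0 ylt.
Qed.

(* The sum runs over all maps, each k-subset being listed k! times, with the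
   same sign twice; this avoids sorting in the proof of the formula. *)
Lemma cauchy_binet (R : comNzRingType) (k n : nat)
    (A : 'M[R]_(k, n)) (B : 'M[R]_(n, k)) :
  \det (A *m B) *+ k`! =
  \sum_(p : {ffun 'I_k -> 'I_n}) \det (colsub p A) * \det (rowsub p B).
Proof.
have detE : \det (A *m B) =
    \sum_(p : {ffun 'I_k -> 'I_n}) (\prod_i A i (p i)) * \det (rowsub p B).
  pose AB (s : 'S_k) i j := A i j * B j (s i).
  transitivity (\sum_(p : {ffun 'I_k -> 'I_n})
      \sum_(s : 'S_k) (-1) ^+ s * \prod_i AB s i (p i)).
    rewrite exchange_big; apply: eq_bigr => /= s _; rewrite -big_distrr /=.
    congr (_ * _); rewrite -(bigA_distr_bigA (AB s)) /=.
    by apply: eq_bigr => x _; rewrite mxE.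
  apply: eq_bigr => p _; rewrite big_distrr /=; apply: eq_bigr => s _.
  rewrite mulrCA big_split //=; congr (_ * (_ * _)).
  by apply: eq_bigr => i _; rewrite mxE.
(* Precomposing [p] with [s] permutes the rows of the second minor and produces the sign of [s];
   summing over all [s] then rebuilds the first minor. *)
have permE (s : 'S_k) : \det (A *m B) = \sum_(p : {ffun 'I_k -> 'I_n})
    ((-1) ^+ s * \prod_i colsub p A i (s i)) * \det (rowsub p B).
  pose h (t : 'S_k) (p : {ffun 'I_k -> 'I_n}) := [ffun i => p (t i)].
  have hK t : cancel (h t) (h t^-1%g).
    by move=> p; apply/ffunP=> i; rewrite !ffunE permKV.
  rewrite detE (reindex_inj (can_inj (hK s))); apply: eq_bigr => p _.
  have -> : rowsub (h s p) B = row_perm s (rowsub p B).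
    by apply/matrixP=> i j; rewrite !mxE ffunE.
  rewrite row_permE det_mulmx det_perm mulrCA -mulrA; congr (_ * (_ * _)).
  by apply: eq_bigr => i _; rewrite ffunE mxE.
rewrite -{1}card_Sn -sumr_const.
under eq_bigr => s _ do rewrite (permE s).
rewrite exchange_big /=; apply: eq_bigr => p _.
by rewrite -big_distrl.
Qed.

(** * Closure properties of total positivity *)

Lemma sort_injection (k n : nat) (p : 'I_k -> 'I_n) : injective p ->
  exists2 g : 'I_k -> 'I_n, increasing_index g &
    exists s : 'S_k, forall i, p i = g (s i).
Proof.
move=> p_inj; pose r : rel 'I_n := fun i j => (i <= j)%N.
pose t := [tuple p i | i < k]; pose u := [tuple of sort r t].
have /tuple_permP [s tE] : perm_eq t u by rewrite perm_sym perm_sort.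
have ut : uniq u.
  by rewrite sort_uniq map_inj_uniq ?enum_uniq.
have r_total : total r by move=> i j; apply: leq_total.
have r_trans : transitive r by move=> i j l; apply: leq_trans.
exists (tnth u); last first.
  exists s => i; transitivity (tnth t i); first by rewrite tnth_mktuple.
  by rewrite (val_inj tE : t = [tuple tnth u (s i) | i < k]) tnth_mktuple.
move=> i j ij; rewrite ltn_neqAle.
have su : size u = k by rewrite size_tuple.
rewrite (inj_eq val_inj) !(tnth_nth (p i)) nth_uniq ?su //.
rewrite (inj_eq val_inj) neq_ltn ij /=.
apply: (sorted_leq_nth r_trans _ _ (sort_sorted r_total t)) => //.
- by rewrite inE su.
- by rewrite inE su.
- exact: ltnW.
Qed.

Lemma TP_mul (R : realType) (r n : nat) (A B : 'M[R]_n) :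
  TP r A -> TP r B -> TP r (A *m B).
Proof.
move=> tpA tpB k f g kr f_incr g_incr.
(* A non-injective [p] repeats a row. An injective one is an increasing [q] after a permutation,
   whose sign occurs in both factors and cancels. *)
have term (p : 'I_k -> 'I_n) :
    0 <= \det (colsub p (rowsub f A)) * \det (rowsub p (colsub g B)).
  have [/injectiveP p_inj|/injectivePn[i1 [i2 i12 pE]]] :=
    boolP (injectiveb p); last first.
    rewrite [X in _ * X](determinant_alternate i12) ?mulr0 // => j.
    by rewrite !mxE pE.
  have [q q_incr [s pE]] := sort_injection p_inj.
  have -> : colsub p (rowsub f A) = col_perm s (mxsub f q A).
    by apply/matrixP=> i j; rewrite !mxE pE.
  have -> : rowsub p (colsub g B) = row_perm s (mxsub q g B).
    by apply/matrixP=> i j; rewrite !mxE pE.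
  rewrite col_permE row_permE !det_mulmx !det_perm odd_permV.
  rewrite mulrA -(mulrA (\det _)) -signr_addb addbb expr0 mulr1.
  by rewrite mulr_ge0 // ltW // ?tpA ?tpB.
have -> : mxsub f g (A *m B) = rowsub f A *m colsub g B.
  by apply/matrixP=> i j; rewrite !mxE; apply: eq_bigr => l _; rewrite !mxE.
(* Strict positivity comes from the single term [p = f]. *)
rewrite -(pmulrn_lgt0 _ (fact_gt0 k)) cauchy_binet.
rewrite (bigD1 (finfun f)) //= ltr_wpDr ?sumr_ge0 //.
have -> : colsub (finfun f) (rowsub f A) = mxsub f f A.
  by apply/matrixP=> i j; rewrite !mxE ffunE.
have -> : rowsub (finfun f) (colsub g B) = mxsub f g B.
  by apply/matrixP=> i j; rewrite !mxE ffunE.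
by rewrite mulr_gt0 ?tpA ?tpB.
Qed.

Lemma TP_tr (R : realType) (r m n : nat) (A : 'M[R]_(m, n)) :
  TP r A -> TP r A^T.
Proof.
move=> tpA k f g kr f_incr g_incr.
by rewrite -trmx_mxsub det_tr tpA.
Qed.

Lemma TP_scale (R : realType) (r m n : nat) (a : 'I_m -> R) (b : 'I_n -> R)
    (A : 'M[R]_(m, n)) : (forall i, 0 < a i) -> (forall j, 0 < b j) ->
  TP r A -> TP r (\matrix_(i, j) (a i * A i j * b j)).
Proof.
move=> a0 b0 tpA k f g kr f_incr g_incr.
have -> : mxsub f g (\matrix_(i, j) (a i * A i j * b j)) =
    \matrix_(i, j) (a (f i) * mxsub f g A i j * b (g j)).
  by apply/matrixP=> i j; rewrite !mxE.
by rewrite det_scale !mulr_gt0 ?prodr_gt0 ?tpA.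
Qed.

Lemma TP_TN (R : realType) (r m n : nat) (A : 'M[R]_(m, n)) :
  TP r A -> TN r A.
Proof. by move=> tpA k f g kr f_incr g_incr; rewrite ltW ?tpA. Qed.

Lemma TP_entry_gt0 (R : realType) (r m n : nat) (A : 'M[R]_(m, n)) i j :
  (0 < r)%N -> TP r A -> 0 < A i j.
Proof.
move=> r0 tpA; have := tpA 1%N (fun=> i) (fun=> j) r0.
by rewrite det_mx11 mxE; apply=> l l'; rewrite !ord1.
Qed.

(** * Limits of determinants and expansion of powers *)

Lemma cvg_sumr (R : realType) (T I : Type) (F : set_system T) (FF : Filter F)
    (s : seq I) (P : pred I) (f : I -> T -> R) (l : I -> R) :
  (forall i, P i -> f i x @[x --> F] --> l i) ->
  \sum_(i <- s | P i) f i x @[x --> F] --> \sum_(i <- s | P i) l i.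
Proof. by move=> fl; apply: cvg_big => //; exact: add_continuous. Qed.

Lemma cvg_prodr (R : realType) (T I : Type) (F : set_system T) (FF : Filter F)
    (s : seq I) (P : pred I) (f : I -> T -> R) (l : I -> R) :
  (forall i, P i -> f i x @[x --> F] --> l i) ->
  \prod_(i <- s | P i) f i x @[x --> F] --> \prod_(i <- s | P i) l i.
Proof. by move=> fl; apply: cvg_big => //; exact: mul_continuous. Qed.

Lemma cvg_exprn (R : realType) (T : Type) (F : set_system T) (FF : Filter F)
    (f : T -> R) (l : R) (m : nat) :
  f x @[x --> F] --> l -> f x ^+ m @[x --> F] --> l ^+ m.
Proof.
move=> fl; elim: m => [|m IHm]; first exact: cvg_cst.
by under eq_cvg do rewrite exprS; rewrite exprS; apply: cvgM.
Qed.

Lemma cvg_det (R : realType) (T : Type) (F : set_system T) (FF : Filter F)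
    (k : nat) (M : T -> 'M[R]_k) (L : 'M[R]_k) :
  (forall i j, M x i j @[x --> F] --> L i j) ->
  \det (M x) @[x --> F] --> \det L.
Proof.
move=> ML; apply: cvg_sumr => s _; apply: cvgM; first exact: cvg_cst.
exact: cvg_prodr.
Qed.

(** Continuity of the remainder factor [r] allows the limit at 0 after powers of [e] have been
    divided out. *)
Lemma expr1D_order2 (R : realType) (m : nat) : exists2 r : R -> R,
  continuous r &
  forall y, (1 + y) ^+ m =
    1 + m%:R * y + 'C(m, 2)%:R * y ^+ 2 + y ^+ 3 * r y.
Proof.
elim: m => [|m [r r_cont rE]].
  by exists (fun=> 0) => [|y]; [exact: cst_continuous|rewrite bin0n /=; ring].
exists (fun y => 'C(m, 2)%:R + r y + y * r y) => [y|y].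
  apply: cvgD; last by apply: cvgM; [exact: cvg_id|exact: r_cont].
  by apply: cvgD; [exact: cvg_cst|exact: r_cont].
by rewrite exprS rE binS bin1 natrD -natr1; ring.
Qed.

(** * The negative minor of the limit kernel *)

Lemma det_mx33 (R : comNzRingType) (M : 'M[R]_3) :
  \det M = M 0 0 * (M 1 1 * M 2 2 - M 1 2 * M 2 1)
         - M 0 1 * (M 1 0 * M 2 2 - M 1 2 * M 2 0)
         + M 0 2 * (M 1 0 * M 2 1 - M 1 1 * M 2 0).
Proof.
pose m (i j : nat) : R := M (inord i) (inord j).
have -> : M = \matrix_(i, j) m i j.
  by apply/matrixP=> i j; rewrite mxE /m !inord_val.
rewrite !(expand_det_row _ 0) !big_ord_recl !big_ord0 /cofactor.
rewrite !(expand_det_row _ 0) !big_ord_recl !big_ord0 /cofactor.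
by rewrite !det_mx11 !mxE /=; ring.
Qed.

(** The sum is an entry of the square of the lower triangular matrix of ones. *)
Lemma big_ord_leq_leq (i k N : nat) :
  (\sum_(m < N) ((m <= i) * (k <= m)) = minn N i.+1 - k)%N.
Proof.
elim: N => [|N IHN]; first by rewrite big_ord0 min0n sub0n.
rewrite big_ord_recr /= {}IHN.
by case: leqP => ?; case: leqP => ?; lia.
Qed.

(** Truncated subtraction on [nat] supplies the positive parts. *)
Definition kink_kernel (R : realType) (e : R) (i j : nat) : R :=
  (i.+1 * j.+1)%:R + e * (i * j + (i - 2) * (j - 2))%:R.

Lemma kink_kernel_power_minor_lt0 (R : realType) (m : nat) : (1 < m)%N ->
  exists2 e : R, 0 < e &
    \det (\matrix_(i < 4, j < 4) kink_kernel e i (bump 1 j) ^+ m) < 0.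
Proof.
move=> m1; have [r r_cont rE] := expr1D_order2 R m.
pose C : R := 'C(m, 2)%:R; pose M : R := m%:R.
have C0 : 0 < C by rewrite ltr0n bin_gt0.
have M0 : 0 < M by rewrite ltr0n ltnW.
(* For a kernel entry [a], [(1 + e * a) ^+ m - 1] is [e * u a e]; for an entry [4 / 3 * a] it is
   [4 / 3 * (e * u a e) + e ^+ 2 * v a e], the terms of order [e] being proportional. *)
pose u (a e : R) := M * a + C * a ^+ 2 * e + a ^+ 3 * e ^+ 2 * r (a * e).
pose v (a e : R) := C * (4 / 9) * a ^+ 2 +
  e * ((4 / 3 * a) ^+ 3 * r (4 / 3 * a * e) - 4 / 3 * a ^+ 3 * r (a * e)).
(* Up to a positive factor the minor is [e ^+ 4 * G e]: after the Schur step
   its second row is 4/3 times the first one up to terms of order [e ^+ 2]. *)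
pose G (e : R) :=
  u (1/3) e * (v (3/8) e * u (7/10) e - v (2/5) e * u (5/8) e)
  - u (3/8) e * (v (1/3) e * u (7/10) e - v (2/5) e * u (1/2) e)
  + u (2/5) e * (v (1/3) e * u (5/8) e - v (3/8) e * u (1/2) e).
have idc : (fun x : R => x) @ (0 : R) --> (0 : R) by exact: cvg_id.
have rc a : r (a * e) @[e --> (0 : R)] --> r (a * 0).
  apply: (cvg_comp (fun e => a * e) r); last exact: r_cont.
  by apply: cvgM => //; exact: cvg_cst.
have uc a : u a e @[e --> (0 : R)] --> u a 0.
  apply: cvgD; first apply: cvgD; first exact: cvg_cst.
    by apply: cvgM => //; exact: cvg_cst.
  apply: cvgM => //; apply: cvgM; first exact: cvg_cst.
  exact: cvg_exprn.
have vc a : v a e @[e --> (0 : R)] --> v a 0.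
  apply: cvgD; first exact: cvg_cst.
  apply: cvgM => //; apply: cvgB; apply: cvgM => //; exact: cvg_cst.
have Gc : G e @[e --> (0 : R)] --> G 0.
  have dc a b c b' c' : u a e * (v b e * u c e - v b' e * u c' e)
      @[e --> (0 : R)] --> u a 0 * (v b 0 * u c 0 - v b' 0 * u c' 0).
    exact: cvgM (uc a) (cvgB (cvgM (vc b) (uc c)) (cvgM (vc b') (uc c'))).
  exact: cvgD (cvgB (dc _ _ _ _ _) (dc _ _ _ _ _)) (dc _ _ _ _ _).
have G0 : G 0 < 0.
  (* [G 0] is [4 / 9 * M ^+ 2 * C] times the determinant with rows (1/3, 3/8, 2/5), their squares,
     and (1/2, 5/8, 7/10), which is -1/28800. *)
  have -> : G 0 = - (M ^+ 2 * C) / (180 * 360).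
    by rewrite /G /u /v; field.
  have : 0 < M ^+ 2 * C by rewrite mulr_gt0 ?exprn_gt0.
  lra.
have [e [e0 Ge]] : exists e, 0 < e /\ G e < 0.
  have /cvgr_lt/(_ _ G0) := cvg_at_right_filter Gc.
  move=> /(filterI (nbhs_right_gt (0 : R))) /filter_ex[e [e0 Ge]].
  by exists e.
exists e => //.
(* After this scaling the first row and column of [N] consist of ones, so the Schur complement just
   subtracts 1 from the other entries. *)
pose k (i j : nat) : R :=
  (i * j + (i - 2) * (j - 2))%:R / (i.+1%:R * j.+1%:R).
pose N := \matrix_(i < 4, j < 4) (1 + e * k i (bump 1 j)) ^+ m.
have -> : \matrix_(i < 4, j < 4) kink_kernel e i (bump 1 j) ^+ m =
    \matrix_(i, j) (i.+1%:R ^+ m * N i j * (bump 1 j).+1%:R ^+ m).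
  apply/matrixP=> i j; rewrite !mxE -!exprMn; congr (_ ^+ _).
  rewrite /kink_kernel /k natrM; field.
  by rewrite !gt_eqF.
have pos (f : 'I_4 -> nat) : 0 < \prod_i (f i).+1%:R ^+ m :> R.
  by apply: prodr_gt0 => i _; rewrite exprn_gt0 ?ltr0Sn.
rewrite det_scale (pmulr_llt0 _ (pos (fun j => bump 1 j))).
rewrite (pmulr_rlt0 _ (pos (fun i => i))).
have N00 : N 0 0 = 1 by rewrite mxE /k mul0n /= !mul0r mulr0 addr0 expr1n.
pose q (i j : nat) : R := (1 + e * k i j) ^+ m - 1.
rewrite det_schur N00 ?oner_eq0 // mul1r.
rewrite [X in \det X](_ : _ = \matrix_(i < 3, j < 3) q i.+1 j.+2); last first.
  apply/matrixP=> i j; rewrite !mxE /q /k !lift0 mul0n muln0.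
  have -> : bump 1 (0%R : 'I_4) = 0%N by [].
  have -> : bump 1 j.+1 = j.+2 by [].
  by rewrite sub0n muln0 mul0n !mul0r !mulr0 addr0 expr1n mul1r divr1.
rewrite det_mx33 !mxE -[X in X < 0]/(
  q 1%N 2%N * (q 2%N 3%N * q 3%N 4%N - q 2%N 4%N * q 3%N 3%N)
  - q 1%N 3%N * (q 2%N 2%N * q 3%N 4%N - q 2%N 4%N * q 3%N 2%N)
  + q 1%N 4%N * (q 2%N 2%N * q 3%N 3%N - q 2%N 3%N * q 3%N 2%N)).
have qu c i j x : (i * j + (i - 2) * (j - 2))%N = c ->
    c%:R / (i.+1%:R * j.+1%:R) = x -> q i j = e * u x e.
  by rewrite /q /k => -> ->; rewrite rE /u [e * x]mulrC -/C -/M; ring.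
have qv c i j x : (i * j + (i - 2) * (j - 2))%N = c ->
    c%:R / (i.+1%:R * j.+1%:R) = 4 / 3 * x ->
    q i j = 4 / 3 * (e * u x e) + e ^+ 2 * v x e.
  by rewrite /q /k => -> ->; rewrite rE /u /v [e * _]mulrC -/C -/M; field.
rewrite (qu 2%N 1%N 2%N (1/3)) //; last by field.
rewrite (qu 3%N 1%N 3%N (3/8)) //; last by field.
rewrite (qu 4%N 1%N 4%N (2/5)) //; last by field.
rewrite (qv 4%N 2%N 2%N (1/3)) //; last by field.
rewrite (qv 6%N 2%N 3%N (3/8)) //; last by field.
rewrite (qv 8%N 2%N 4%N (2/5)) //; last by field.
rewrite (qu 6%N 3%N 2%N (1/2)) //; last by field.
rewrite (qu 10%N 3%N 3%N (5/8)) //; last by field.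
rewrite (qu 14%N 3%N 4%N (7/10)) //; last by field.
(* Subtracting [s] times the first row from the second leaves rows of order [e], [e ^+ 2] and
   [e]. *)
have -> : forall u1 u2 u3 v1 v2 v3 w1 w2 w3 s : R,
  e * u1 * ((s * (e * u2) + e ^+ 2 * v2) * (e * w3)
    - (s * (e * u3) + e ^+ 2 * v3) * (e * w2))
  - e * u2 * ((s * (e * u1) + e ^+ 2 * v1) * (e * w3)
    - (s * (e * u3) + e ^+ 2 * v3) * (e * w1))
  + e * u3 * ((s * (e * u1) + e ^+ 2 * v1) * (e * w2)
    - (s * (e * u2) + e ^+ 2 * v2) * (e * w1)) =
  e ^+ 4 * (u1 * (v2 * w3 - v3 * w2) - u2 * (v1 * w3 - v3 * w1)
    + u3 * (v1 * w2 - v2 * w1)) by move=> *; ring.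
by rewrite pmulr_rlt0 ?exprn_gt0.
Qed.


(** * Totally positive perturbation of the kernel *)

(* For h > 0 both cases equal x_i / (x_i + y_j) (see [soft_stepE]); this form
   stays continuous at h = 0. *)
Definition soft_step (R : realType) (h : R) (i j : nat) : R :=
  if (j <= i)%N then (1 + h ^+ (i - j).*2.+1)^-1
  else h ^+ (j - i).*2.-1 / (1 + h ^+ (j - i).*2.-1).

Lemma soft_stepE (R : realType) (h : R) (i j : nat) : 0 < h ->
  soft_step h i j = h^-1 ^+ i.*2.+1 * (h^-1 ^+ i.*2.+1 + h^-1 ^+ j.*2)^-1.
Proof.
move=> h0; rewrite /soft_step; case: leqP => [ji|ij].
  rewrite -{2 3}(subnK ji) doubleD -addSn exprD.
  have : 0 < h^-1 ^+ j.*2 by rewrite exprn_gt0 ?invr_gt0.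
  have : 0 < h ^+ (i - j).*2.+1 by rewrite exprn_gt0.
  rewrite !(exprVn h (i - j).*2.+1); set a := _ ^+ _; set b := _ ^+ _.
  by move=> a0 b0; field; rewrite !gt_eqF ?addr_gt0 ?mulr_gt0.
have -> : j.*2 = ((j - i).*2.-1 + i.*2.+1)%N by lia.
rewrite exprD.
have : 0 < h^-1 ^+ i.*2.+1 by rewrite exprn_gt0 ?invr_gt0.
have : 0 < h ^+ (j - i).*2.-1 by rewrite exprn_gt0.
rewrite !(exprVn h (j - i).*2.-1); set a := _ ^+ _; set b := _ ^+ _.
by move=> a0 b0; field; rewrite !gt_eqF ?addr_gt0 ?mulr_gt0.
Qed.

Lemma soft_step0 (R : realType) (i j : nat) :
  soft_step (0 : R) i j = (j <= i)%:R.
Proof.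
rewrite /soft_step; case: leqP => [_|ij]; first by rewrite expr0n addr0 invr1.
(* Since [i < j], the exponent is a successor, so this power of 0 vanishes. *)
have -> : (j - i).*2.-1 = (j - i).-1.*2.+1 by lia.
by rewrite expr0n mul0r.
Qed.

Lemma cvg_soft_step (R : realType) (i j : nat) :
  soft_step h i j @[h --> (0 : R)] --> soft_step (0 : R) i j.
Proof.
have Xc m : h ^+ m @[h --> (0 : R)] --> (0 : R) ^+ m.
  by apply: cvg_exprn; exact: cvg_id.
have Vc m : (1 + h ^+ m.+1)^-1 @[h --> (0 : R)] --> (1 + (0 : R) ^+ m.+1)^-1.
  apply: cvgV; first by rewrite expr0n addr0 oner_eq0.
  by apply: cvgD; [exact: cvg_cst|exact: Xc].
rewrite /soft_step; case: leqP => [ji|ij]; first exact: Vc.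
have -> : (j - i).*2.-1 = (j - i).-1.*2.+1 by lia.
by apply: cvgM; [exact: Xc|exact: Vc].
Qed.

(** Each minor is, up to positive row factors, a Cauchy determinant; its nodes increase because
    [h^-1] exceeds 1. *)
Lemma TP_soft_step (R : realType) (r n : nat) (h : R) : 0 < h < 1 ->
  TP r (\matrix_(i < n, j < n) soft_step h i j).
Proof.
move=> /andP[h0 h1] k f g kr f_incr g_incr.
pose H := h^-1.
have H0 m : 0 < H ^+ m by rewrite exprn_gt0 ?invr_gt0.
have H_incr a b : (a < b)%N -> H ^+ a < H ^+ b.
  by move=> ab; rewrite ltr_eXn2l // invf_gt1.
have -> : mxsub f g (\matrix_(i < n, j < n) soft_step h i j) =
    \matrix_(i, j) (H ^+ (f i).*2.+1 *
      (\matrix_(i', j') (H ^+ (f i').*2.+1 + H ^+ (g j').*2)^-1) i j * 1).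
  by apply/matrixP=> i j; rewrite !mxE mulr1 soft_stepE.
rewrite det_scale [X in _ * X]big1 // mulr1 mulr_gt0 ?prodr_gt0 //.
apply: det_cauchy_gt0 => // i j ij; apply: H_incr.
- by rewrite ltnS ltn_double f_incr.
- by rewrite ltn_double g_incr.
Qed.

Definition soft_spline (R : realType) (n : nat) (h : R) : 'M[R]_n :=
  (\matrix_(i < n, j < n) soft_step h i j)
    *m (\matrix_(i < n, j < n) soft_step h i j).

(** The default of [nth] puts [h] at every position from 4 on, so all weights are positive for
    positive [e] and [h]. *)
Definition spline_weight (R : realType) (e h : R) (k : nat) : R :=
  nth h [:: 1; e; h; e] k.

(** The factor 1 matches the two-sided scaling in [TP_scale]. *)
Definition spline_gram (R : realType) (n : nat) (e h : R) : 'M[R]_n :=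
  (\matrix_(i, j) (1 * soft_spline n h i j * spline_weight e h j))
    *m (soft_spline n h)^T.

Lemma soft_spline0 (R : realType) (n : nat) (i j : 'I_n) :
  soft_spline n (0 : R) i j = (i.+1 - j)%:R.
Proof.
rewrite mxE -[in RHS](minn_idPr (ltn_ord i)) -big_ord_leq_leq natr_sum.
by apply: eq_bigr => m _; rewrite !mxE !soft_step0 -natrM.
Qed.

(** Only columns 0, 1 and 3 keep a nonzero weight; their entries in row [i] are i+1, i and
    (i-2)_+. *)
Lemma spline_gram0 (R : realType) (n : nat) (e : R) (i j : 'I_n) :
  (4 <= n)%N -> spline_gram n e 0 i j = kink_kernel e i j.
Proof.
case: n i j => [|[|[|[|n]]]] // i j _; rewrite mxE.
under eq_bigr => k _ do
  rewrite [X in X * _]mxE [X in _ * X]mxE mul1r !soft_spline0.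
rewrite !big_ord_recl big1 => [|k _]; last first.
  by rewrite /spline_weight !lift0 /= nth_nil mulr0 mul0r.
rewrite /spline_weight !lift0 /= /kink_kernel !subn0 !subSS !subn0.
by rewrite natrD !natrM; ring.
Qed.

Lemma cvg_spline_gram (R : realType) (n : nat) (e : R) (i j : 'I_n) :
  spline_gram n e h i j @[h --> (0 : R)] --> spline_gram n e 0 i j.
Proof.
have Pc (a b : 'I_n) :
    soft_spline n h a b @[h --> (0 : R)] --> soft_spline n (0 : R) a b.
  rewrite mxE; under eq_cvg do rewrite mxE.
  apply: cvg_sumr => k _; rewrite !mxE; under eq_cvg do rewrite !mxE.
  by apply: cvgM; exact: cvg_soft_step.
have wc k : spline_weight e h k @[h --> (0 : R)] --> spline_weight e 0 k.
  by rewrite /spline_weight; case: k => [|[|[|[|k]]]] /=;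
    rewrite ?nth_nil; under eq_cvg do rewrite ?nth_nil;
    [exact: cvg_cst|exact: cvg_cst|exact: cvg_id|exact: cvg_cst|exact: cvg_id].
rewrite mxE; under eq_cvg do rewrite mxE.
apply: cvg_sumr => k _; rewrite [X in X * _]mxE [X in _ * X]mxE.
under eq_cvg do rewrite [X in X * _]mxE [X in _ * X]mxE.
apply: cvgM; last exact: Pc.
apply: cvgM; last exact: wc.
by apply: cvgM; [exact: cvg_cst|exact: Pc].
Qed.

Lemma symTP_spline_gram (R : realType) (r n : nat) (e h : R) :
  0 < e -> 0 < h < 1 -> symTP R r n (spline_gram n e h).
Proof.
move=> e0 h01; have h0 : 0 < h by case/andP: h01.
have tpP : TP r (soft_spline n h) by apply: TP_mul; exact: TP_soft_step.
split.
  apply/matrixP=> i j; rewrite !mxE; apply: eq_bigr => k _.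
  by rewrite !mxE; ring.
apply: TP_mul; last exact: TP_tr.
apply: TP_scale => // k.
by rewrite /spline_weight; case: (val k) => [|[|[|[|l]]]] //=; rewrite nth_nil.
Qed.

(** First [e] is fixed by the limit kernel, then [h] is taken small enough to keep the minor
    negative by continuity. *)
Lemma symTP_power_minor_lt0 (R : realType) (r n m : nat) :
  (4 < n)%N -> (0 < r)%N -> (1 < m)%N ->
  exists2 A, symTP R r n A &
    exists f g : 'I_4 -> 'I_n, [/\ increasing_index f, increasing_index g &
      \det (mxsub f g (hadamard_power A m%:R)) < 0].
Proof.
move=> n4 r0 m1; have [e e0 dlt0] := kink_kernel_power_minor_lt0 R m1.
have f_lt (i : 'I_4) : (i < n)%N by rewrite (leq_trans (ltn_ord i)) // ltnW.
have g_lt (j : 'I_4) : (bump 1 j < n)%N.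
  by rewrite (leq_ltn_trans _ n4) // /bump; have := ltn_ord j; lia.
pose f i := Ordinal (f_lt i); pose g j := Ordinal (g_lt j).
pose d h := \det (\matrix_(i, j) spline_gram n e h (f i) (g j) ^+ m).
have dc : d h @[h --> (0 : R)] --> d 0.
  apply: cvg_det => i j; rewrite mxE; under eq_cvg do rewrite mxE.
  by apply: cvg_exprn; exact: cvg_spline_gram.
have d0 : d 0 < 0.
  rewrite /d; under eq_mx => i j do rewrite spline_gram0 ?(ltnW n4) //.
  exact: dlt0.
have [h /andP[h0 h1] dh] : exists2 h, 0 < h < 1 & d h < 0.
  have /cvgr_lt/(_ _ d0) := cvg_at_right_filter dc.
  move=> /(filterI (nbhs_right_lt (ltr01 : (0 : R) < 1))).
  move=> /(filterI (nbhs_right_gt (0 : R))) /filter_ex[h [h0 [h1 dh]]].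
  by exists h => //; apply/andP.
have sA : symTP R r n (spline_gram n e h).
  by apply: symTP_spline_gram => //; rewrite h0.
exists (spline_gram n e h) => //; exists f, g; split.
- by [].
- by move=> i j ij /=; rewrite /bump; lia.
- rewrite [X in \det X](_ : _ =
    \matrix_(i, j) spline_gram n e h (f i) (g j) ^+ m) //.
  (* Entries are positive, so the real power at [m%:R] is the ordinary [m]-th power. *)
  apply/matrixP=> i j; rewrite [LHS]mxE [LHS]mxE [RHS]mxE powR_mulrn //.
  by apply/ltW/(TP_entry_gt0 _ _ r0); case: sA.
Qed.

Lemma hadamard_critical_exponent_pinfty (R : realType) (m n : nat)
    (C : set 'M[R]_(m, n)) :
  (forall T : R, exists2 A, C A &
    exists2 t, T <= t & ~ C (hadamard_power A t)) ->
  hadamard_critical_exponent C = +oo%E.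
Proof.
move=> noT; rewrite /hadamard_critical_exponent -[RHS](ereal_inf0 R).
congr ereal_inf; rewrite -subset0 => x [T [_ CT] _].
by have [A CA [t Tt []]] := noT T; exact: CT.
Qed.

Theorem mainTheorem7 (R : realType) (n r : nat) (hn : (5 <= n)%N)
  (hr : (4 <= r)%N) :
  hadamard_critical_exponent (symTN R r n) = +oo%E /\
  hadamard_critical_exponent (symTP R r n) = +oo%E.
Proof.
(* One matrix serves both classes: it is TP, hence TN, while its power is not TN, hence not TP. *)
have fails (T : R) : exists2 A, symTP R r n A & exists2 t, T <= t &
    ~ TN r (hadamard_power A t).
  (* The shift by 2 guarantees an exponent above 1, whatever [T] is. *)
  pose m := (Num.bound `|T|).+2.
  have r0 : (0 < r)%N by exact: leq_trans hr.
  have [A sA [f [g [f_incr g_incr dlt0]]]] :=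
    @symTP_power_minor_lt0 R r n m hn r0 isT.
  exists A => //; exists m%:R.
    rewrite (le_trans (ler_norm T)) // ltW //.
    rewrite (lt_le_trans (archi_boundP (normr_ge0 T))) // ler_nat /m.
    by rewrite leqW.
  by move=> /(_ 4 f g hr f_incr g_incr); rewrite leNgt dlt0.
split; apply: hadamard_critical_exponent_pinfty => T;
  have [A [symA tpA] [t Tt ntn]] := fails T; exists A => //.
- by split=> //; exact: TP_TN.
- by exists t => // -[].
- by exists t => // -[_ /TP_TN].
Qed.
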